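(* Let $P$ be a simplicial poset, $K$ a field, and $x,z\in P$ with $x\ge z$. Then there is a nonzero clean map $E_x\to E_z$, and it is unique up to scalar multiplication by elements of $K$.
   Context: Face ring. A simplicial poset is a finite poset $P$ with least element $\hat 0$ such that $\{y\in P\mid y\le x\}$ is isomorphic to a boolean algebra for every $x\in P$; $\operatorname{rank} x$ is the rank of this boolean algebra. Put $P^*=P\setminus\{\hat 0\}$. For $x_1,\dots,x_m\in P$, $[x_1\vee\cdots\vee x_m]$ is the set of minimal elements of $\{z\in P\mid z\ge x_1,\dots,x_m\}$. If $[x\vee y]\neq\emptyset$, then $\{z\mid z\le x,\ z\le y\}$ has a greatest element $x\wedge y$. Let $S=K[t_x\mid x\in P^*]$ be the polynomial ring over the field $K$, set $t_{\hat 0}=1$, and for $x,y\in P^*$ let $f_{x,y}=t_xt_y-t_{x\wedge y}\sum_{z\in[x\vee y]}t_z$ (interpreted as $t_xt_y$ if $[x\vee y]=\emptyset$). Let $I_P=(f_{x,y}\mid x,y\in P^* )\subset S$. Grading. Let $y_1,\dots,y_n$ be the rank 1 elements of $P$, $t_i:=t_{y_i}$, and $\operatorname{supp}(x)=\{i\mid y_i\le x\}$ for $x\in P$. $S$ is $\mathbb{Z}^n$-graded by $\deg t_x=\sum_{i\in\operatorname{supp}(x)}\mathbf{e}_i$, where $\mathbf e_i$ is the $i$-th coordinate vector. The module $E_x$. For $x\in P$ let $\mathfrak{p}_x=(t_z\mid z\in P^*, z\not\le x)+I_P$, and $S_x=S/\mathfrak{p}_x\cong K[t_i\mid i\in\operatorname{supp}(x)]$;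 the surjection $\pi_x:S\to S_x$ sends $t_z$ to $\prod_{i\in\operatorname{supp}(z)}t_i$ if $z\le x$, and to $0$ otherwise. Let $P^*_{-x}=P^*\setminus\{y_i\mid i\in\operatorname{supp}(x)\}$ and $$E_x=K[t_i^{\pm1}\mid i\in\operatorname{supp}(x)]\otimes_K K[t_z^{-1}\mid z\in P^*_{-x}].$$ Here the first factor is an $S$-module via $\pi_x$; the second is Macaulay's inverse system, an $S$-module on which $t_i$ ($i\in\operatorname{supp}(x)$) acts as $0$ and $t_w$ ($w\in P^*_{-x}$) sends a monomial $\prod_z t_z^{-a_z}$ ($a_z\in\mathbb{N}$, with $0\in\mathbb N$) to the monomial with $a_w$ replaced by $a_w-1$ if $a_w>0$, and to $0$ if $a_w=0$. $S$ acts on $E_x$ by $t_z\cdot(u\otimes v)=\pi_x(t_z)u\otimes v+u\otimes t_zv$ for $z\in P^*$. $E_x$ is $\mathbb{Z}^n$-graded by $\deg(u\otimes v)=\deg u+\deg v$, with $\deg t_z^{-1}=-\deg t_z$. ($E_x$ is the injective envelope of $S/\mathfrak p_x$ in the category of $\mathbb Z^n$-graded $S$-modules.) Clean maps. The total degree of a homogeneous element of $\mathbb{Z}^n$-degree $(a_1,\dots,a_n)$ is $\deg_{\mathbb Z}=\sum a_i$. For $m\in\mathbb N$, $E_x^{-m}$ is the $K$-span of the $u\otimes v\in E_x$ with $u$, $v$ monomials in the respective factors and $\deg_{\mathbb Z}v=-m$. Let $\mathcal L(E_x)=\big[\bigoplus_{i\ge1}E_x^{-i}\big]_{\ge\mathbf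 0}$, where $[\,\cdot\,]_{\ge\mathbf 0}$ is the sum of the components of $\mathbb Z^n$-degree $\mathbf a$ with all entries of $\mathbf a$ nonnegative (this is a $K$-subspace of $E_x$). A degree-preserving $S$-homomorphism $\psi:E_x\to E_z$ is called clean if $\psi(\mathcal L(E_x))\subset\mathcal L(E_z)$. *)

(* Defs.v *)
From HB Require Import structures.
From mathcomp Require Import all_boot all_order all_algebra finmap.
From mathcomp.multinomials Require Export monalg.

Set Implicit Arguments.
Unset Strict Implicit.
Unset Printing Implicit Defensive.

Import Order.TTheory GRing.Theory Num.Theory.

Local Open Scope ring_scope.

Section Poset.
Context {d : Order.disp_t} {P : finBPOrderType d}.

(* The interval below x is isomorphic to the lattice of subsets of a k-element
   set; k is then the rank of x. *)
Definition has_rank (x : P) (k : nat) : bool :=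
  [exists f : {ffun {set 'I_k} -> P},
    [forall A, forall B, (f A <= f B)%O == (A \subset B)] &&
    [forall y, (y <= x)%O == (y \in codom f)]].

Definition atoms : {set P} := [set y | has_rank y 1].

Definition atom (i : 'I_#|atoms|) : P := enum_val i.

Definition supp (x : P) : {set 'I_#|atoms|} := [set i | (atom i <= x)%O].

(* P^*_{-x}, as a subset of P^* *)
Definition in_Pminus (x : P) (z : {z : P | z != \bot%O}) : bool :=
  val z \notin [set atom i | i in supp x].

End Poset.

Definition simplicial {d : Order.disp_t} (P : finBPOrderType d) : Prop :=
  forall x : P, exists k : nat, has_rank x k.

Notation Pstar P := {z : P | z != \bot%O}.

Notation Zn P := {ffun 'I_#|@atoms _ P| -> int}.

Notation polyS P K := {malg K[{cmonom (Pstar P)}]}.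

(* Monomials u of K[t_i^{+-1} | i in supp x] and v of K[t_z^{-1} | z in P^*_{-x}]:
   u i is the exponent of t_i, and v z is minus the exponent of t_z. *)
Notation laurent_mon x := {ffun {i | i \in supp x} -> int}.
Notation macaulay_mon x := {ffun {z | in_Pminus x z} -> nat}.
Definition Emon {d : Order.disp_t} {P : finBPOrderType d} (x : P) : choiceType :=
  (laurent_mon x * macaulay_mon x)%type.

Lemma malg_sum (T : choiceType) (R : nzRingType) (e : {malg R[T]}) :
  e = \sum_(b <- msupp e) e@_b *: (<< b >> : {malg R[T]}).
Proof.
rewrite {1}[e]monalgE; apply: eq_bigr => b _.
by apply/malgP => k; rewrite mcoeffZ !mcoeffU mulrnAr mulr1.
Qed.

Section Degree.
Context {d : Order.disp_t} {P : finBPOrderType d}.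

Definition deg_e (i : 'I_#|@atoms _ P|) : Zn P := [ffun j => (j == i)%:R].

Definition deg_t (z : P) : Zn P := \sum_(i in supp z) deg_e i.

Definition deg_laurent (x : P) (u : laurent_mon x) : Zn P :=
  \sum_i deg_e (val i) *~ u i.

Definition deg_macaulay (x : P) (v : macaulay_mon x) : Zn P :=
  - \sum_z deg_t (val (val z)) *+ v z.

Definition deg_mon (x : P) (b : Emon x) : Zn P :=
  deg_laurent b.1 + deg_macaulay b.2.

Definition total_deg (a : Zn P) : int := \sum_i a i.

End Degree.

Section Monomials.
Context {d : Order.disp_t} {P : finBPOrderType d} {K : fieldType} {x : P}.

(* A monomial or, for None, zero. *)
Definition mono_or0 (o : option (Emon x)) : {malg K[Emon x]} :=
  if o is Some b then << b >> else 0.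

(* u multiplied by pi_x(t_z) *)
Definition laurent_act (z : Pstar P) (u : laurent_mon x) :
    option (laurent_mon x) :=
  if (val z <= x)%O then Some [ffun i => u i + (val i \in supp (val z))%:R]
  else None.

(* Macaulay's action of t_z; insub z = None exactly when t_z is one of the t_i
   with i in supp x. *)
Definition macaulay_act (z : Pstar P) (v : macaulay_mon x) :
    option (macaulay_mon x) :=
  if insub z is Some w then
    if v w is k.+1 then Some [ffun w' => if w' == w then k else v w'] else None
  else None.

Definition t_mon (z : Pstar P) (b : Emon x) : {malg K[Emon x]} :=
  mono_or0 (omap (fun u => (u, b.2) : Emon x) (laurent_act z b.1)) +
  mono_or0 (omap (fun v => (b.1, v) : Emon x) (macaulay_act z b.2)).

End Monomials.

(* t_act and S_act are locked so that unification does not unfold them to sums. *)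
HB.lock Definition t_act {d : Order.disp_t} {P : finBPOrderType d}
    (K : fieldType) (x : P) (z : Pstar P) (e : {malg K[Emon x]}) :
    {malg K[Emon x]} :=
  \sum_(b <- msupp e) e@_b *: t_mon z b.
Arguments t_act {d P K x} z e.

(* The order in which the variables act is immaterial: see t_actC. *)
Definition mon_act {d : Order.disp_t} {P : finBPOrderType d} (K : fieldType)
    (x : P) (m : {cmonom (Pstar P)}) (e : {malg K[Emon x]}) : {malg K[Emon x]} :=
  foldr (fun z => iter (m z) (t_act z)) e (enum {: Pstar P}).

HB.lock Definition S_act {d : Order.disp_t} {P : finBPOrderType d}
    (K : fieldType) (x : P) (p : polyS P K) (e : {malg K[Emon x]}) :
    {malg K[Emon x]} :=
  \sum_(m <- msupp p) p@_m *: mon_act m e.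
Arguments S_act {d P K x} p e.

Section Action.
Context {d : Order.disp_t} {P : finBPOrderType d} {K : fieldType} {x : P}.
Implicit Types (e : {malg K[Emon x]}).

Local Notation t_mon := (@t_mon d P K x).
Local Notation t_act := (@t_act d P K x).
Local Notation mon_act := (@mon_act d P K x).
Local Notation S_act := (@S_act d P K x).
Local Notation mono_or0 := (@mono_or0 d P K x).
Local Notation laurent_act := (@laurent_act d P x).
Local Notation macaulay_act := (@macaulay_act d P x).

Lemma t_actEw (D : {fset (Emon x)}) z e : (msupp e `<=` D)%fset ->
  t_act z e = \sum_(b <- D) e@_b *: t_mon z b.
Proof.
move=> le; rewrite t_act.unlock [LHS](big_fset_incl _ le) => //= b _ /mcoeff_outdom ->.
by rewrite scale0r.
Qed.

Lemma t_act_linear z : linear (t_act z).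
Proof.
move=> c e1 e2; pose D := (msupp e1 `|` msupp e2)%fset.
have le1 : (msupp e1 `<=` D)%fset by apply: fsubsetUl.
have le2 : (msupp e2 `<=` D)%fset by apply: fsubsetUr.
have le : (msupp (c *: e1 + e2) `<=` D)%fset.
  apply: fsubset_trans (msuppD_le _ _) _; apply: fsetSU; exact: msuppZ_le.
rewrite (t_actEw _ le) (t_actEw _ le1) (t_actEw _ le2).
rewrite scaler_sumr -big_split /=; apply: eq_bigr => b _.
by rewrite mcoeffD mcoeffZ scalerDl scalerA.
Qed.

HB.instance Definition _ z :=
  GRing.isLinear.Build K _ _ _ (t_act z) (t_act_linear z).

Lemma t_actZ z c e : t_act z (c *: e) = c *: t_act z e.
Proof. exact: linearZ. Qed.

Lemma t_actD z e1 e2 : t_act z (e1 + e2) = t_act z e1 + t_act z e2.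
Proof. exact: linearD. Qed.

Lemma t_act_sum z (T : Type) (r : seq T) (F : T -> {malg K[Emon x]}) :
  t_act z (\sum_(i <- r) F i) = \sum_(i <- r) t_act z (F i).
Proof. exact: linear_sum. Qed.

Lemma t_actU z b : t_act z << b >> = t_mon z b.
Proof. by rewrite (t_actEw _ msuppU_le) big_seq_fset1 mcoeffUU scale1r. Qed.

Lemma t_act_mono_or0 z o : t_act z (mono_or0 o) = oapp (t_mon z) 0 o.
Proof. by case: o => [b|] /=; rewrite ?t_actU ?linear0. Qed.

Lemma laurent_actC z w u :
  obind (laurent_act z) (laurent_act w u) =
  obind (laurent_act w) (laurent_act z u).
Proof.
rewrite /laurent_act; case: ifP => hw; case: ifP => hz //=; rewrite ?hw ?hz //.
by congr Some; apply/ffunP => i; rewrite !ffunE addrAC.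
Qed.

Lemma macaulay_actC z w v :
  obind (macaulay_act z) (macaulay_act w v) =
  obind (macaulay_act w) (macaulay_act z v).
Proof.
have [-> //|neq_zw] := eqVneq z w.
rewrite /macaulay_act; case: insubP => [w' _ Ew|_]; case: insubP => [z' _ Ez|_];
  try by [|case: (v _)].
have nzw : (z' == w') = false.
  by apply/eqP => E; move: neq_zw; rewrite -Ew -Ez E eqxx.
case Ev: (v w') => [|k]; case Eu: (v z') => [|l] //=.
- by rewrite ffunE [w' == z']eq_sym nzw Ev.
- by rewrite ffunE nzw Eu.
rewrite !ffunE [w' == z']eq_sym nzw Ev Eu; congr Some; apply/ffunP => y.
by rewrite !ffunE; case: (eqVneq y z') => [->|//]; rewrite nzw.
Qed.

Lemma t_actC z w e : t_act z (t_act w e) = t_act w (t_act z e).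
Proof.
have tU z' w' : t_act z' (t_act w' e) =
    \sum_(b <- msupp e) e@_b *: t_act z' (t_act w' << b >>).
  rewrite [in LHS](malg_sum e) (t_act_sum w') (t_act_sum z').
  by apply: eq_bigr => b _; rewrite (t_actZ w') (t_actZ z').
rewrite !tU; apply: eq_bigr => b _; rewrite !t_actU; congr (_ *: _).
rewrite /t_mon !t_actD !t_act_mono_or0.
pose pair2 ou ov := obind (fun u => omap (fun v => (u, v) : Emon x) ov) ou.
have tL z' v o : oapp (t_mon z') 0 (omap (fun u => (u, v) : Emon x) o) =
    mono_or0 (omap (fun u => (u, v) : Emon x) (obind (laurent_act z') o)) +
    mono_or0 (pair2 o (macaulay_act z' v)).
  by case: o => [u|] //=; rewrite addr0.
have tM z' u o : oapp (t_mon z') 0 (omap (fun v => (u, v) : Emon x) o) =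
    mono_or0 (pair2 (laurent_act z' u) o) +
    mono_or0 (omap (fun v => (u, v) : Emon x) (obind (macaulay_act z') o)).
  case: o => [v|] /=; last by rewrite addr0; case: (laurent_act z' u).
  by congr (mono_or0 _ + _); case: (laurent_act z' u).
rewrite !tL !tM laurent_actC macaulay_actC -!addrA; congr (_ + _).
by rewrite addrCA.
Qed.

Lemma mon_act_linear m : linear (mon_act m).
Proof.
rewrite /mon_act; elim: (enum _) => [|z s IHs] c e1 e2 //=; rewrite IHs.
by elim: (m z) => [|k IHk] //=; rewrite IHk linearP.
Qed.

HB.instance Definition _ m :=
  GRing.isLinear.Build K _ _ _ (mon_act m) (mon_act_linear m).

Lemma mon_actZ m c e : mon_act m (c *: e) = c *: mon_act m e.
Proof. exact: linearZ. Qed.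

Lemma mon_act_sum m (T : Type) (r : seq T) (F : T -> {malg K[Emon x]}) :
  mon_act m (\sum_(i <- r) F i) = \sum_(i <- r) mon_act m (F i).
Proof. exact: linear_sum. Qed.

Lemma mon_act1 e : mon_act mone e = e.
Proof. by rewrite /mon_act; elim: (enum _) => //= z s ->; rewrite cm1. Qed.

Lemma mon_actM m1 m2 e : mon_act (mmul m1 m2) e = mon_act m1 (mon_act m2 e).
Proof.
rewrite /mon_act; elim: (enum _) => //= z s IHs.
have iter_comm k w f : iter k (t_act w) (t_act z f) = t_act z (iter k (t_act w) f).
  by elim: k => //= k ->; rewrite t_actC.
have foldr_comm k f :
    foldr (fun w => iter (m1 w) (t_act w)) (iter k (t_act z) f) s =
    iter k (t_act z) (foldr (fun w => iter (m1 w) (t_act w)) f s).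
  elim: s {IHs} => //= w s ->; move: (foldr _ _ _) => g.
  by elim: k => //= k IHk; rewrite iter_comm IHk.
by rewrite cmM iterD IHs foldr_comm.
Qed.

Lemma S_actEw (D : {fset {cmonom (Pstar P)}}) p e : (msupp p `<=` D)%fset ->
  S_act p e = \sum_(m <- D) p@_m *: mon_act m e.
Proof.
move=> le; rewrite S_act.unlock [LHS](big_fset_incl _ le) => //= b _ /mcoeff_outdom ->.
by rewrite scale0r.
Qed.

Lemma S_actU c m e : S_act << c *g m >> e = c *: mon_act m e.
Proof. by rewrite (S_actEw _ msuppU_le) big_seq_fset1 mcoeffUU. Qed.

Lemma S_actC (c : K) e : S_act c%:MP e = c *: e.
Proof. by rewrite S_actU mon_act1. Qed.

Lemma S_actX z e : S_act << ucm z >> e = t_act z e.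
Proof.
rewrite S_actU scale1r /mon_act.
have := enum_uniq {: Pstar P}; have := mem_enum {: Pstar P} z.
rewrite inE; elim: (enum _) => //= w s IHs; rewrite inE => zs /andP[ws us].
have id_out : z \notin s ->
    foldr (fun w => iter (ucm z w) (t_act w)) e s = e.
  elim: s {IHs zs ws us} => //= y s IHs; rewrite inE negb_or => /andP[zy zs].
  by rewrite IHs // cmU (negbTE zy).
have [Ezw|neq_zw] := eqVneq z w.
  by subst w; rewrite id_out // cmUU.
rewrite cmU (negbTE neq_zw) /= IHs //.
by rewrite (negbTE neq_zw) in zs.
Qed.

Lemma S_actDl (e : {malg K[Emon x]}) : {morph S_act^~ e : p q / p + q}.
Proof.
move=> p q; pose D := (msupp p `|` msupp q)%fset.
rewrite (@S_actEw D p) ?fsubsetUl // (@S_actEw D q) ?fsubsetUr //.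
rewrite (@S_actEw D (p + q)) ?msuppD_le // -big_split /=.
by apply: eq_bigr => m _; rewrite mcoeffD scalerDl.
Qed.

Lemma S_act_linear p : linear (S_act p).
Proof.
move=> c e1 e2; rewrite S_act.unlock scaler_sumr -big_split; apply: eq_bigr => m _ /=.
by rewrite linearP scalerDr !scalerA mulrC.
Qed.

HB.instance Definition _ p :=
  GRing.isLinear.Build K _ _ _ (S_act p) (S_act_linear p).

Lemma S_actA p q e : S_act p (S_act q e) = S_act (p * q) e.
Proof.
have S_act0 f : S_act 0 f = 0 by rewrite S_act.unlock msupp0 big_seq_fset0.
rewrite malgME (big_morph _ (S_actDl e) (S_act0 e)).
rewrite (S_actEw _ (fsubset_refl (msupp p))); apply: eq_bigr => m1 _.
rewrite (big_morph _ (S_actDl e) (S_act0 e)).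
rewrite (S_actEw _ (fsubset_refl (msupp q))) mon_act_sum scaler_sumr.
by apply: eq_bigr => m2 _; rewrite mon_actZ scalerA S_actU mon_actM.
Qed.

Lemma S_act1 e : S_act 1 e = e.
Proof. by rewrite S_actU scale1r mon_act1. Qed.

End Action.

(* The K-space with basis the monomials u (x) v; its module structure is over S. *)
Definition E {d : Order.disp_t} {P : finBPOrderType d} (K : fieldType) (x : P) :
  Type := {malg K[Emon x]}.

Section Module.
Context {d : Order.disp_t} {P : finBPOrderType d} (K : fieldType) (x : P).

HB.instance Definition _ := GRing.Zmodule.copy (E K x) {malg K[Emon x]}.

HB.instance Definition _ :=
  GRing.Zmodule_isLmodule.Build (polyS P K) (E K x) (@S_actA d P K x)
    (@S_act1 d P K x) (fun p => linearD (S_act p)) (@S_actDl d P K x).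

Definition homogeneous (a : Zn P) (e : E K x) : Prop :=
  forall b, b \in msupp e -> deg_mon b = a.

(* L(E_x): being spanned by monomials, it is described by the supports of its
   elements. *)
Definition in_L (e : E K x) : Prop :=
  forall b, b \in msupp e ->
    (exists i : nat, (1 <= i)%N /\ total_deg (deg_macaulay b.2) = - i%:Z) /\
    (forall j, 0 <= deg_mon b j).

End Module.

Definition clean {d : Order.disp_t} {P : finBPOrderType d} {K : fieldType}
    {x z : P} (psi : {linear E K x -> E K z}) : Prop :=
  (forall a e, homogeneous a e -> homogeneous a (psi e)) /\
  (forall e, in_L e -> in_L (psi e)).

(* Main.v *)
Require Import Defs.
From HB Require Import structures.
From mathcomp Require Import all_boot all_order all_algebra finmap.
From mathcomp Require Import zify.
Import Order.TTheory GRing.Theory Num.Theory.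
Local Open Scope ring_scope.

Set Implicit Arguments.
Unset Strict Implicit.
Unset Printing Implicit Defensive.

(** On [E_z] the element [s_w = t_w - pi_z(t_w)], for [w] in [P^*_{-z}], lowers
    the exponent of [t_w^-1] and does nothing else.  Hence the coefficient of
    [e] at [u (x) prod_w t_w^(-a_w)] is that of [prod_w s_w^(a_w) e] at
    [u (x) 1], and an [S]-linear map [psi : E_x -> E_z] is determined by the
    coefficients of its values at the [u (x) 1].  The [t_i] with [i] in
    [supp z] act invertibly on both modules, so the coefficient at [1 (x) 1]
    alone suffices; if [psi] preserves degrees, this is a linear form on the
    part of degree zero of [E_x].  Cleanness makes the form vanish on every
    monomial [u (x) v] of degree zero with [v <> 1], because such a monomial
    lies in [L(E_x)] whereas [1 (x) 1] does not occur in elements of [L(E_z)].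
    What remains is the value at [1 (x) 1], one scalar: this is the uniqueness
    ([mcoeff0_macaulay], [mcoeff1_macaulay], [clean_eq0]).

    For the existence, take the form that reads off the coefficient of
    [1 (x) 1] and recover [psi] from it.  On [E_x], [s_w] again lowers the
    exponent of [t_w^-1], except that for [w <= x], [w </= z] it is this
    operator plus multiplication by [pi_x(t_w)].  Expanding the powers of the
    commuting [s_w] by the binomial theorem, the coefficient of
    [psi (u (x) v)] at [u' (x) v'] is zero unless the two degrees agree, and is
    then the product over all [w] of ['C(v' w, v w)] if [w <= x] and
    [w </= z], and of [v' w == v w] otherwise ([clean_coef]).  The proof starts
    from this closed formula.  Three facts make it work:
    - only finitely many [u' (x) v'] occur ([clean_coef_bound]): in a
      simplicial poset an element [w <= x] with [w </= z] lies above an atom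
      that is not below [z] ([le_supp]), and in the direction of this atom the
      degree bounds [v' w];
    - [psi] commutes with [t_w], which for [w <= x], [w </= z] is Pascal's rule
      ([wt_pascal], [clean_coef_t_act]);
    - [psi] is clean, since a nonzero coefficient forces [v <= v'], so that
      [v <> 1] implies [v' <> 1]. *)

(** * Atoms and supports in a simplicial poset *)

Section Supports.
Context {d : Order.disp_t} {P : finBPOrderType d}.
Implicit Types w x y z : P.

Lemma has_rankP x k :
  reflect (exists f : {set 'I_k} -> P,
             (forall A B, (f A <= f B)%O = (A \subset B)) /\
             (forall y, (y <= x)%O <-> exists A, y = f A))
          (has_rank x k).
Proof.
apply: (iffP existsP) => [[f /andP[le_f sur_f]]|[f [le_f sur_f]]].
  exists f; split=> [A B|y]; first exact/eqP/(forallP (forallP le_f A)).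
  rewrite (eqP (forallP sur_f y)); split=> [/codomP //|[A ->]].
  exact: codom_f.
exists (finfun f); apply/andP; split.
  by apply/forallP => A; apply/forallP => B; rewrite !ffunE le_f.
apply/forallP => y; apply/eqP; apply/idP/codomP => [/sur_f[A ->]|[A ->]].
  by exists A; rewrite ffunE.
by rewrite ffunE; apply/sur_f; exists A.
Qed.

Lemma sub_set1 (I : finType) (i : I) (A : {set I}) :
  A \subset [set i] -> A = set0 \/ A = [set i].
Proof. by rewrite subset1 => /orP[] /eqP; [right|left]. Qed.

Lemma atomsP y :
  reflect (y != \bot%O /\ forall w, (w <= y)%O -> w = \bot%O \/ w = y)
          (y \in atoms).
Proof.
rewrite inE; apply: (iffP idP) => [/has_rankP[f [le_f sur_f]]|[yN0 min_y]].
  have f0 : f set0 = \bot%O.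
    have /sur_f[A botE] := le0x y.
    by apply/eqP; rewrite -lex0 botE le_f sub0set.
  have fT : f [set ord0] = y.
    have /sur_f fle : exists A, f [set ord0] = f A by exists [set ord0].
    have /sur_f[A yE] := lexx y; apply: le_anti; rewrite fle /= yE le_f.
    by apply/subsetP => i _; rewrite inE (ord1 i).
  split=> [|w /sur_f[A ->]].
    by rewrite -f0 -fT eq_le !le_f sub0set andbT subset0 -card_gt0 cards1.
  have [|->|->] := @sub_set1 _ ord0 A; rewrite ?f0 ?fT; auto.
  by apply/subsetP => i _; rewrite inE (ord1 i).
apply/has_rankP; exists (fun A => if A == set0 then \bot%O else y).
split=> [A B|w].
  have [->|] := eqVneq A set0; first by rewrite le0x sub0set.
  have [->|/set0Pn[i Bi] _] := eqVneq B set0.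
    by rewrite subset0 lex0 (negPf yN0) => /negPf.
  rewrite lexx; apply/esym/subsetP => j _.
  by rewrite (ord1 j) -(ord1 i).
split=> [/min_y[] ->|[A ->]]; first by exists set0; rewrite eqxx.
  by exists [set ord0]; rewrite -cards_eq0 cards1.
by case: ifP => _; rewrite ?le0x.
Qed.

(** The interval below [x] is a boolean lattice, in which an element is the
    join of its atoms; two elements without a common upper bound may well have
    the same support. *)
Lemma le_supp x w z : simplicial P -> (w <= x)%O -> (z <= x)%O ->
  supp w \subset supp z -> (w <= z)%O.
Proof.
move=> /(_ x)[k /has_rankP[f [le_f sur_f]]] /sur_f[A ->] /sur_f[B ->].
move=> /subsetP sub; rewrite le_f; apply/subsetP => i Ai.
have f0 : f set0 = \bot%O.
  have /sur_f[C botE] := le0x x.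
  by apply/eqP; rewrite -lex0 botE le_f sub0set.
have f1_atom : f [set i] \in atoms.
  apply/atomsP; split=> [|y le_y].
    by rewrite -f0 eq_le !le_f sub0set andbT subset0 -card_gt0 cards1.
  have /sur_f[C yE] : (y <= x)%O.
    by apply: le_trans le_y _; apply/sur_f; exists [set i].
  by move: le_y; rewrite yE le_f => /sub_set1[->|->]; [left|right].
have /sub : enum_rank_in f1_atom (f [set i]) \in supp (f A).
  by rewrite inE /atom enum_rankK_in // le_f sub1set.
by rewrite inE /atom enum_rankK_in // le_f sub1set.
Qed.

Lemma supp_neq0 w : simplicial P -> w != \bot%O -> (0 < #|supp w|)%N.
Proof.
move=> simP; rewrite card_gt0; apply: contraNneq => w0; rewrite -lex0.
by apply: (@le_supp w w) => //; rewrite ?le0x ?w0 ?sub0set.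
Qed.

Lemma supp_mono z x : (z <= x)%O -> supp z \subset supp x.
Proof.
by move=> le_zx; apply/subsetP => i; rewrite !inE => /le_trans; apply.
Qed.

Lemma atom_neq0 (i : 'I_#|@atoms d P|) : atom i != \bot%O.
Proof. by have /atomsP[] := enum_valP i. Qed.

Lemma supp_atom (i : 'I_#|@atoms d P|) : supp (atom i) = [set i].
Proof.
apply/setP => j; rewrite !inE; apply/idP/eqP => [|-> //].
have /atomsP[_ min_i] := enum_valP i.
by case/min_i => [/eqP|/enum_val_inj //]; rewrite (negPf (atom_neq0 j)).
Qed.

End Supports.

(** * Exponents and degrees of monomials *)

Lemma big_sub_insub (R : Type) (idx : R) (op : Monoid.com_law idx)
    (I : finType) (p : pred I) (F : {i | p i} -> R) :
  \big[op/idx]_(i : {i | p i}) F i = \big[op/idx]_i oapp F idx (insub i).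
Proof.
rewrite [RHS](bigID p) /= [X in op _ X]big1 => [|i pi]; last by rewrite insubN.
rewrite Monoid.mulm1 (reindex_omap (val : {i | p i} -> I) insub) => [|i pi].
  by apply: eq_big => [j|j _]; rewrite valK ?(valP j) ?eqxx.
by rewrite insubT.
Qed.

Section Exponents.
Context {d : Order.disp_t} {P : finBPOrderType d} {x : P}.
Implicit Types (u : laurent_mon x) (v : macaulay_mon x) (w : Pstar P)
  (b : Emon x) (i : 'I_#|@atoms d P|).

(** Exponents are extended by zero to all of the [t_i] and [t_w], so that
    monomials of different modules [E_x] become comparable; those of the
    second factor are negated. *)
Definition lexp u i : int := oapp u 0 (insub i).
Definition mexp v w : nat := oapp v 0%N (insub w).

Lemma lexp_val u j : lexp u (val j) = u j.
Proof. by rewrite /lexp valK. Qed.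

Lemma mexp_val v j : mexp v (val j) = v j.
Proof. by rewrite /mexp valK. Qed.

Lemma lexp_out u i : i \notin supp x -> lexp u i = 0.
Proof. by move=> ix; rewrite /lexp insubN. Qed.

Lemma mexp_out v w : ~~ in_Pminus x w -> mexp v w = 0%N.
Proof. by move=> wx; rewrite /mexp insubN. Qed.

Lemma lexp_inj u1 u2 : lexp u1 =1 lexp u2 -> u1 = u2.
Proof. by move=> e; apply/ffunP => i; rewrite -!lexp_val e. Qed.

Lemma mexp_inj v1 v2 : mexp v1 =1 mexp v2 -> v1 = v2.
Proof. by move=> e; apply/ffunP => i; rewrite -!mexp_val e. Qed.

Lemma deg_tE (w : P) j : deg_t w j = (j \in supp w)%:R.
Proof.
rewrite /deg_t sum_ffunE; have [jw|jw] := boolP (j \in supp w).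
  rewrite (bigD1 j) //= ffunE eqxx big1 ?addr0 // => i /andP[_ /negPf ij].
  by rewrite ffunE eq_sym ij.
rewrite big1 // => i iw; rewrite ffunE; case: eqP => // ji.
by rewrite ji iw in jw.
Qed.

Lemma deg_laurentE u j : deg_laurent u j = lexp u j.
Proof.
rewrite /deg_laurent sum_ffunE (bigID (fun i : {i | i \in supp x} => val i == j)) /=.
rewrite [X in _ + X]big1 => [|i ij]; last first.
  by rewrite ffunMzE ffunE eq_sym (negPf ij) mul0rz.
rewrite addr0 /lexp; case: insubP => [j' _ <-|jx] /=.
  rewrite (big_pred1 j') => [|i]; last by rewrite /= val_eqE.
  by rewrite ffunMzE ffunE eqxx intz.
by rewrite big_pred0 // => i; apply: contraNF jx => /eqP <-; apply: valP.
Qed.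

Lemma deg_macaulayE v j :
  deg_macaulay v j = - \sum_w (mexp v w)%:Z * (j \in supp (val w))%:R.
Proof.
rewrite /deg_macaulay ffunE sum_ffunE big_sub_insub; congr (- _).
apply: eq_bigr => w _; rewrite /mexp; case: insubP => [w' _ <-|_] /=.
  by rewrite ffunMnE deg_tE -[LHS]mulr_natl natz.
by rewrite mul0r.
Qed.

Lemma deg_monE b j :
  deg_mon b j =
    lexp b.1 j - \sum_w (mexp b.2 w)%:Z * (j \in supp (val w))%:R.
Proof. by rewrite /deg_mon ffunE deg_laurentE deg_macaulayE. Qed.

(** The degree determines the Laurent factor once the other factor is known. *)
Lemma Emon_eq b1 b2 :
  deg_mon b1 = deg_mon b2 -> mexp b1.2 =1 mexp b2.2 -> b1 = b2.
Proof.
case: b1 b2 => [u1 v1] [u2 v2] deg12 /= v12; congr pair; last exact: mexp_inj.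
apply: lexp_inj => j; have /ffunP/(_ j) := deg12.
by rewrite !deg_monE /= (mexp_inj v12) => /addIr.
Qed.

(** Division by [t_w] in the two factors: it lowers an exponent in the first
    and raises the negated exponent in the second. *)
Definition ldiv w u : laurent_mon x :=
  [ffun i => u i - (val i \in supp (val w))%:R].
Definition mdiv w v : macaulay_mon x := [ffun i => v i + (val i == w)]%N.

Lemma mexp_mdiv w v w' :
  in_Pminus x w -> mexp (mdiv w v) w' = (mexp v w' + (w' == w))%N.
Proof.
move=> wx; rewrite /mexp; case: insubP => [j _ <-|w'x] /=; first by rewrite ffunE.
by case: eqP w'x => // ->; rewrite wx.
Qed.

Lemma lexp_ldiv w u i : (val w <= x)%O ->
  lexp (ldiv w u) i = lexp u i - (i \in supp (val w))%:R.
Proof.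
move=> /supp_mono/subsetP le_wx; rewrite /lexp.
case: insubP => [j _ <-|ix] /=; first by rewrite ffunE.
by rewrite (contraNF (le_wx i) ix) subr0.
Qed.

Lemma deg_mon_ldiv w u v : (val w <= x)%O ->
  deg_mon ((ldiv w u, v) : Emon x) = deg_mon ((u, v) : Emon x) - deg_t (val w).
Proof.
move=> le_wx; apply/ffunP => j; rewrite !ffunE -/(deg_mon _) !deg_laurentE.
by rewrite deg_tE lexp_ldiv //= addrAC.
Qed.

Lemma deg_mon_mdiv w u v : in_Pminus x w ->
  deg_mon ((u, mdiv w v) : Emon x) = deg_mon ((u, v) : Emon x) - deg_t (val w).
Proof.
move=> wx; apply/ffunP => j; rewrite [RHS]ffunE [X in _ + X]ffunE.
rewrite !deg_monE /= deg_tE -addrA.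
congr (_ + _); rewrite -opprD; congr (- _).
under eq_bigr do rewrite mexp_mdiv // PoszD mulrDl.
rewrite big_split /=; congr (_ + _).
by rewrite (bigD1 w) //= eqxx mul1r big1 ?addr0 // => w' /negPf ->; rewrite mul0r.
Qed.

End Exponents.

(** * The action of the variables, coefficientwise *)

Section Action.
Context {d : Order.disp_t} {P : finBPOrderType d} {K : fieldType} {x : P}.
Implicit Types (u : laurent_mon x) (v : macaulay_mon x) (w : Pstar P)
  (b : Emon x) (e : {malg K[Emon x]}).

Lemma laurent_actE w u u' :
  (laurent_act w u == Some u') = (val w <= x)%O && (u == ldiv w u').
Proof.
rewrite /laurent_act; case: ifP => //= _; rewrite (inj_eq Some_inj).
by apply/eqP/eqP => [<-|->]; apply/ffunP => i; rewrite !ffunE ?addrK ?subrK.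
Qed.

Lemma macaulay_actE w v v' :
  (macaulay_act w v == Some v') = in_Pminus x w && (v == mdiv w v').
Proof.
rewrite /macaulay_act; case: insubP => [i -> iw|/negPf -> //] /=.
case vi: (v i) => [|k].
  by apply/esym/eqP => /ffunP/(_ i); rewrite ffunE vi iw eqxx addn1.
rewrite (inj_eq Some_inj); apply/eqP/eqP => [<-|vE]; apply/ffunP => j.
  by rewrite !ffunE -iw val_eqE; case: eqP => [->|]; rewrite ?vi ?addn1 ?addn0.
rewrite ffunE; case: eqP => [->|/eqP ji]; last first.
  by rewrite vE ffunE -iw val_eqE (negPf ji) addn0.
by move: vi; rewrite vE ffunE iw eqxx addn1 => -[].
Qed.

Lemma mcoeff_mono_or0 (o : option (Emon x)) b :
  (mono_or0 o : {malg K[Emon x]})@_b = (o == Some b)%:R.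
Proof. by case: o => [b'|] /=; rewrite ?mcoeff0 // mcoeffU (inj_eq Some_inj). Qed.

Lemma mcoeff_t_mon w c b :
  (t_mon w c : {malg K[Emon x]})@_b =
    ((val w <= x)%O && (c == (ldiv w b.1, b.2)))%:R +
    (in_Pminus x w && (c == (b.1, mdiv w b.2)))%:R.
Proof.
case: c b => [u v] [u' v'] /=; rewrite mcoeffD !mcoeff_mono_or0 !xpair_eqE.
congr (_%:R + _%:R).
  by rewrite andbA -laurent_actE; case: laurent_act.
by rewrite andbCA -macaulay_actE; case: macaulay_act; rewrite ?andbF.
Qed.

(** Reading the action backwards avoids case distinctions on vanishing
    products: a monomial has at most one preimage under [t_w] in either factor,
    obtained by division. *)
Lemma mcoeff_t_act w e b :
  (t_act w e)@_b =
    (if (val w <= x)%O then e@_((ldiv w b.1, b.2) : Emon x) else 0) +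
    (if in_Pminus x w then e@_((b.1, mdiv w b.2) : Emon x) else 0).
Proof.
have coefE b' : e@_b' = \sum_(c <- msupp e) e@_c * (c == b')%:R.
  rewrite {1}(malg_sum e) raddf_sum /=; apply: eq_bigr => c _.
  by rewrite mcoeffZ mcoeffU.
have ifE (q : bool) b' : (if q then e@_b' else 0) =
    \sum_(c <- msupp e) e@_c * (q && (c == b'))%:R.
  by case: q; rewrite ?coefE // big1 // => c _; rewrite mulr0.
rewrite !ifE -big_split /= t_act.unlock raddf_sum; apply: eq_bigr => c _ /=.
by rewrite mcoeffZ mcoeff_t_mon mulrDr.
Qed.

End Action.

Section Linear.
Context {d : Order.disp_t} {P : finBPOrderType d} {K : fieldType} {x z : P}.

(** The [t_w] generate [S] as a [K]-algebra. *)
Lemma S_linearP (psi : E K x -> E K z) :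
  (forall (c : K) e1 e2, psi (c *: (e1 : {malg K[Emon x]}) + e2 : {malg K[Emon x]}) =
     (c *: (psi e1 : {malg K[Emon z]}) + psi e2 : {malg K[Emon z]})) ->
  (forall w e, psi (t_act w e) = t_act w (psi e)) ->
  linear psi.
Proof.
move=> psiK psit.
have psiD e1 e2 : psi (e1 + e2) = psi e1 + psi e2.
  by have := psiK 1 e1 e2; rewrite !scale1r.
have psi0 : psi 0 = 0 by apply: (addIr (psi 0)); rewrite -psiD !add0r.
have psiZ (c : K) e :
    psi (c *: (e : {malg K[Emon x]})) = c *: (psi e : {malg K[Emon z]}).
  by have := psiK c e 0; rewrite psi0 !addr0.
have psi_mon m e : psi (mon_act m e) = mon_act m (psi e).
  rewrite /mon_act; elim: (enum _) => //= w s <-.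
  by elim: (m w) => //= k <-; rewrite psit.
move=> p e1 e2; rewrite psiD; congr (_ + _).
rewrite /GRing.scale /= !S_act.unlock (big_morph psi psiD psi0).
by apply: eq_bigr => m _; rewrite psiZ psi_mon.
Qed.

Lemma linear_t_act (psi : {linear E K x -> E K z}) w e :
  psi (t_act w e) = t_act w (psi e).
Proof. by have := linearZZ psi << ucm w >> e; rewrite /GRing.scale /= !S_actX. Qed.

Lemma linear_malgZ (psi : {linear E K x -> E K z}) (c : K)
    (e : {malg K[Emon x]}) :
  psi (c *: e) = c *: (psi e : {malg K[Emon z]}).
Proof. by have := linearZZ psi c%:MP e; rewrite /GRing.scale /= !S_actC. Qed.

End Linear.

(** * The coefficients of the clean map *)

Section Coefficients.
Context {d : Order.disp_t} {P : finBPOrderType d} {x z : P}.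
Implicit Types (v : macaulay_mon x) (w : Pstar P) (b : Emon x) (c : Emon z).

Definition wt w (m k : nat) : nat :=
  if (val w <= x)%O && ~~ (val w <= z)%O then 'C(m, k) else (m == k).

Definition wt_prod v (v' : macaulay_mon z) : nat :=
  \prod_(w : Pstar P) wt w (mexp v' w) (mexp v w).

Definition clean_coef b c : nat :=
  if deg_mon b == deg_mon c then wt_prod b.2 c.2 else 0%N.

Lemma in_PminusE (y : P) w : (val w <= y)%O -> in_Pminus y w = (val w \notin atoms).
Proof.
move=> le_wy; rewrite /in_Pminus; congr (~~ _).
apply/imsetP/idP => [[i _ ->]|w_atom]; first exact: enum_valP.
by exists (enum_rank_in w_atom (val w)); rewrite ?inE /atom enum_rankK_in.
Qed.

Lemma in_Pminus_nle (y : P) w : ~~ (val w <= y)%O -> in_Pminus y w.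
Proof.
by apply: contra => /imsetP[i]; rewrite inE => le_iy ->.
Qed.

(** What commutation with [t_w] amounts to at the index [w]: multiplying by
    [t_w] before the map, on the left, or after it, on the right.  The last two premises
    express that [k] and [m] are exponents extended by zero. *)
Lemma wt_pascal w m k : (z <= x)%O ->
  (~~ in_Pminus x w -> k = 0%N) -> (~~ in_Pminus z w -> m = 0%N) ->
  ((if (val w <= x)%O then wt w m k else 0) +
     (if k is k1.+1 then wt w m k1 else 0) =
   (if (val w <= z)%O then wt w m k else 0) +
     (if in_Pminus z w then wt w m.+1 k else 0))%N.
Proof.
move=> le_zx; have [le_wz|nle_wz] := boolP (val w <= z)%O.
  have le_wx := le_trans le_wz le_zx.
  rewrite /wt le_wx le_wz /= !in_PminusE //; case: ifP => _ k0 m0; congr addn.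
    by case: k k0.
  by rewrite k0.
rewrite /wt nle_wz andbT (in_Pminus_nle nle_wz).
have [le_wx|nle_wx] := boolP (val w <= x)%O => k0 _.
  by case: k {k0} => [|k]; rewrite ?bin0 //= ?binS.
by case: k {k0} => [|k].
Qed.

Variant macaulay_act_spec w v : option (macaulay_mon x) -> nat -> Prop :=
  | MacaulayActNone : macaulay_act_spec w v None 0
  | MacaulayActSome v1 of in_Pminus x w & v = mdiv w v1 :
      macaulay_act_spec w v (Some v1) (mexp v1 w).+1.

Lemma macaulay_actP w v : macaulay_act_spec w v (macaulay_act w v) (mexp v w).
Proof.
case E: (macaulay_act w v) => [v1|].
  have /eqP := E; rewrite macaulay_actE => /andP[wx /eqP vE].
  by rewrite {2}vE mexp_mdiv // eqxx addn1; constructor.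
suff -> : mexp v w = 0%N by constructor.
move: E; rewrite /macaulay_act /mexp; case: insubP => //= i _ _.
by case: (v i).
Qed.

Lemma wt_prodD1 w v (v' : macaulay_mon z) :
  wt_prod v v' = (wt w (mexp v' w) (mexp v w) *
    \prod_(w' | w' != w) wt w' (mexp v' w') (mexp v w'))%N.
Proof. by rewrite /wt_prod (bigD1 w). Qed.

Lemma wt_prod_mdivr w v (v' : macaulay_mon z) : in_Pminus z w ->
  wt_prod v (mdiv w v') = (wt w (mexp v' w).+1 (mexp v w) *
    \prod_(w' | w' != w) wt w' (mexp v' w') (mexp v w'))%N.
Proof.
move=> wx; rewrite (wt_prodD1 w) mexp_mdiv // eqxx addn1; congr muln.
by apply: eq_bigr => w' /negPf ww'; rewrite mexp_mdiv // ww' addn0.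
Qed.

Lemma clean_coef_t_act w b c : (z <= x)%O ->
  (oapp (fun u => clean_coef (u, b.2) c) 0 (laurent_act w b.1) +
     oapp (fun v => clean_coef (b.1, v) c) 0 (macaulay_act w b.2) =
   (if (val w <= z)%O then clean_coef b (ldiv w c.1, c.2) else 0) +
     (if in_Pminus z w then clean_coef b (c.1, mdiv w c.2) else 0))%N.
Proof.
move=> le_zx; case: b c => [u v] [u' v']; cbn [fst snd].
(* The degree conditions of all four terms are equivalent to D. *)
pose D := deg_mon ((u, v) : Emon x) + deg_t (val w) == deg_mon ((u', v') : Emon z).
have -> : oapp (fun u => clean_coef (u, v) (u', v')) 0%N (laurent_act w u) =
    (if D then if (val w <= x)%O then wt_prod v v' else 0 else 0)%N.
  case E: (laurent_act w u) => [u1|] /=; last first.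
    by move: E; rewrite /laurent_act; case: ifP => //; case: D.
  have /eqP := E; rewrite laurent_actE => /andP[le_wx /eqP uE].
  by rewrite le_wx /clean_coef /D uE deg_mon_ldiv // subrK.
have -> : (if (val w <= z)%O then clean_coef (u, v) (ldiv w u', v') else 0)%N =
    (if D then if (val w <= z)%O then wt_prod v v' else 0 else 0)%N.
  case: ifP => [le_wz|]; last by case: D.
  by rewrite /clean_coef /D deg_mon_ldiv // eq_sym subr_eq eq_sym.
have -> : (if in_Pminus z w then clean_coef (u, v) (u', mdiv w v') else 0)%N =
    (if D then if in_Pminus z w then wt_prod v (mdiv w v') else 0 else 0)%N.
  case: ifP => [wz|]; last by case: D.
  by rewrite /clean_coef /D deg_mon_mdiv // eq_sym subr_eq eq_sym.
have -> : oapp (fun v => clean_coef (u, v) (u', v')) 0%N (macaulay_act w v) =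
    (if D then oapp (wt_prod^~ v') 0 (macaulay_act w v) else 0)%N.
  case: macaulay_actP => /= [|v1 wx vE]; first by case: D.
  by rewrite /clean_coef /D vE deg_mon_mdiv // subrK.
case: D => //.
set R := \prod_(w' | w' != w) wt w' (mexp v' w') (mexp v w').
have wt_w := @wt_pascal w (mexp v' w) (mexp v w) le_zx
  (@mexp_out _ _ _ v w) (@mexp_out _ _ _ v' w).
transitivity (((if (val w <= x)%O then wt w (mexp v' w) (mexp v w) else 0) +
  (if mexp v w is k.+1 then wt w (mexp v' w) k else 0)) * R)%N.
  rewrite mulnDl; congr addn; first by case: ifP; rewrite // (wt_prodD1 w).
  case: macaulay_actP => //= v1 wx vE; rewrite (wt_prodD1 w); congr muln.
  by apply: eq_bigr => w' /negPf ww'; rewrite vE mexp_mdiv // ww' addn0.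
rewrite wt_w mulnDl; congr addn; case: ifP => // wz.
  by rewrite (wt_prodD1 w).
by rewrite wt_prod_mdivr.
Qed.
End Coefficients.
Arguments wt {d P} x z w m k.

(** * Construction of the clean map *)

Section CleanMap.
Context {d : Order.disp_t} {P : finBPOrderType d} {K : fieldType} {x z : P}.
Implicit Types (v : macaulay_mon x) (w : Pstar P) (b : Emon x) (c : Emon z).

Lemma clean_coef_neq0 b c : clean_coef b c != 0%N ->
  deg_mon b = deg_mon c /\
  forall w, wt x z w (mexp c.2 w) (mexp b.2 w) != 0%N.
Proof.
rewrite /clean_coef; case: (deg_mon b =P _) => // deg_bc nz; split=> // w.
by apply: contra nz => /eqP w0; rewrite (wt_prodD1 w) w0.
Qed.

Definition exp_bound b : nat :=
  (\sum_w mexp b.2 w + \sum_j `|deg_mon b j|)%N.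

(** For [w <= x], [w </= z], choose an atom [y_i <= w] with [i] outside
    [supp z].  The first factor of [c] does not involve [t_i], so minus the
    [i]-th entry of its degree is a sum of exponents that includes the one
    of [w]. *)
Lemma clean_coef_bound b c w : simplicial P -> (z <= x)%O ->
  clean_coef b c != 0%N -> (mexp c.2 w <= exp_bound b)%N.
Proof.
move=> simP le_zx /clean_coef_neq0[deg_bc /(_ w)]; rewrite /wt.
case: ifP => [/andP[le_wx nle_wz] _|_]; last first.
  case: (mexp c.2 w =P _) => // -> _; apply: leq_trans (leq_addr _ _).
  by rewrite (bigD1 w) //= leq_addr.
have /subsetPn[i iw iz] := contra (le_supp simP le_wx le_zx) nle_wz.
apply: leq_trans (leq_addl _ _).
apply: leq_trans (_ : `|deg_mon b i| <= _)%N; last first.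
  by rewrite (bigD1 i) //= leq_addr.
rewrite deg_bc deg_monE lexp_out // sub0r abszN (bigD1 w) //= iw mulr1.
set s := \sum_(_ | _) _.
have : 0 <= s by apply: sumr_ge0 => ? _; rewrite mulr_ge0 ?ler0n.
by lia.
Qed.

(** The only candidate for a monomial of degree [a] with second factor [v]; its
    degree differs from [a] if [a - deg v] is not supported on [supp z]. *)
Definition mon_of_deg (a : Zn P) (v : macaulay_mon z) : Emon z :=
  ([ffun i => a (val i) - deg_macaulay v (val i)], v).

Local Notation bounded_exps b :=
  {ffun {w | in_Pminus z w} -> 'I_(exp_bound b).+1}.

Definition clean_supp b : {fset Emon z} :=
  [fset mon_of_deg (deg_mon b) [ffun i => val ((f : bounded_exps b) i)]
  | f in {: bounded_exps b}]%fset.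

Lemma clean_coef_supp b c : simplicial P -> (z <= x)%O ->
  clean_coef b c != 0%N -> c \in clean_supp b.
Proof.
move=> simP le_zx nz; have [deg_bc _] := clean_coef_neq0 nz.
apply/imfsetP; exists ([ffun i => inord (c.2 i)] : bounded_exps b) => //=.
have -> : [ffun i => val (([ffun i => inord (c.2 i)] : bounded_exps b) i)] = c.2.
  apply/ffunP => i; rewrite !ffunE /= inordK ?ltnS -?mexp_val //.
  exact: clean_coef_bound.
rewrite /mon_of_deg deg_bc; case: c {nz deg_bc} => u v; congr pair => /=.
by apply/ffunP => i; rewrite !ffunE addrK deg_laurentE lexp_val.
Qed.

Definition clean_row b : {malg K[Emon z]} :=
  \sum_(c <- clean_supp b) (clean_coef b c)%:R *: << c >>.

Lemma mcoeff_clean_row b c : simplicial P -> (z <= x)%O ->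
  (clean_row b)@_c = (clean_coef b c)%:R.
Proof.
move=> simP le_zx; rewrite raddf_sum /=.
under eq_bigr do rewrite mcoeffZ mcoeffU -natrM.
have [c0|nz] := eqVneq (clean_coef b c) 0%N.
  by rewrite c0 big1 // => c' _; case: eqP => [->|]; rewrite ?c0 ?muln0.
rewrite (big_fsetD1 c) ?clean_coef_supp //= eqxx muln1 big_seq big1 ?addr0 //.
by move=> c'; rewrite !inE => /andP[/negPf -> _]; rewrite muln0.
Qed.

Definition clean_map (e : {malg K[Emon x]}) : {malg K[Emon z]} :=
  \sum_(b <- msupp e) e@_b *: clean_row b.

Lemma clean_mapEw (D : {fset Emon x}) e : (msupp e `<=` D)%fset ->
  clean_map e = \sum_(b <- D) e@_b *: clean_row b.
Proof.
move=> le; rewrite [LHS](big_fset_incl _ le) => //= b _ /mcoeff_outdom ->.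
by rewrite scale0r.
Qed.

Lemma clean_map_linear : linear clean_map.
Proof.
move=> k e1 e2; pose D := (msupp e1 `|` msupp e2)%fset.
rewrite (@clean_mapEw D e1) ?fsubsetUl // (@clean_mapEw D e2) ?fsubsetUr //.
rewrite (@clean_mapEw D); last first.
  apply: fsubset_trans (msuppD_le _ _) _; apply: fsetSU; exact: msuppZ_le.
rewrite scaler_sumr -big_split /=; apply: eq_bigr => b _.
by rewrite mcoeffD mcoeffZ scalerDl scalerA.
Qed.

Lemma mcoeff_clean_map e c : simplicial P -> (z <= x)%O ->
  (clean_map e)@_c = \sum_(b <- msupp e) e@_b * (clean_coef b c)%:R.
Proof.
move=> simP le_zx; rewrite raddf_sum /=; apply: eq_bigr => b _.
by rewrite mcoeffZ mcoeff_clean_row.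
Qed.

HB.instance Definition _ :=
  GRing.isLinear.Build K _ _ _ clean_map clean_map_linear.

Lemma clean_mapU b : clean_map << b >> = clean_row b.
Proof. by rewrite (clean_mapEw msuppU_le) big_seq_fset1 mcoeffUU scale1r. Qed.

Lemma clean_map_mono_or0 o : clean_map (mono_or0 o) = oapp clean_row 0 o.
Proof. by case: o => [b|] /=; rewrite ?clean_mapU ?linear0. Qed.

Lemma clean_map_t_act w e : simplicial P -> (z <= x)%O ->
  clean_map (t_act w e) = t_act w (clean_map e).
Proof.
move=> simP le_zx.
have -> : t_act w e = \sum_(b <- msupp e) e@_b *: t_mon w b by rewrite t_act.unlock.
rewrite [LHS]linear_sum [clean_map e]/clean_map t_act_sum.
apply: eq_bigr => b _; rewrite linearZ t_actZ /=; congr (_ *: _).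
apply/malgP => c; rewrite mcoeff_t_act !mcoeff_clean_row // linearD /=.
rewrite mcoeffD !clean_map_mono_or0.
have oappE T (g : T -> Emon x) (o : option T) :
    (oapp clean_row 0 (omap g o))@_c = (oapp (fun t => clean_coef (g t) c) 0%N o)%:R.
  by case: o => [t|] /=; rewrite ?mcoeff0 ?mcoeff_clean_row.
have ifE (q : bool) n : (if q then n%:R else 0) = (if q then n else 0)%N%:R :> K.
  by case: q.
by rewrite !oappE !ifE -!natrD clean_coef_t_act.
Qed.

Lemma clean_map_S_linear : simplicial P -> (z <= x)%O ->
  linear (clean_map : E K x -> E K z).
Proof.
move=> simP le_zx; apply: S_linearP => [k e1 e2|w e]; first exact: linearP.
exact: clean_map_t_act.
Qed.

End CleanMap.

(** * Total degree and the monomial 1 *)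

Section Clean.
Context {d : Order.disp_t} {P : finBPOrderType d}.
Implicit Types (w : Pstar P).

Lemma macaulay_neq0P (x : P) (v : macaulay_mon x) :
  v != [ffun=> 0%N] -> exists w, mexp v w != 0%N.
Proof.
move=> v0; apply/existsP; apply: contraNT v0 => /existsPn v0.
apply/eqP/ffunP => i; rewrite ffunE -mexp_val; apply/eqP.
by have := v0 (val i); rewrite negbK.
Qed.

Lemma total_deg_macaulay (x : P) (v : macaulay_mon x) :
  total_deg (deg_macaulay v) = - (\sum_w mexp v w * #|supp (val w)|)%N%:Z.
Proof.
rewrite /total_deg (eq_bigr _ (fun j _ => deg_macaulayE v j)).
rewrite sumrN exchange_big /=; congr (- _).
rewrite (big_morph Posz PoszD (erefl _)); apply: eq_bigr => w _.
rewrite -mulr_sumr PoszM; congr (_ * _); rewrite -[X in _ = Posz X]sum1_card.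
rewrite (big_morph Posz PoszD (erefl _)) [RHS]big_mkcond.
by apply: eq_bigr => j _; case: ifP.
Qed.

(** The condition on the first index in [L(E_x)] says that the second factor
    is not [1]: every [t_w] has positive total degree, as an atom lies
    below [w]. *)
Lemma total_deg_macaulay_lt0 (x : P) (v : macaulay_mon x) : simplicial P ->
  (exists i : nat, (1 <= i)%N /\ total_deg (deg_macaulay v) = - i%:Z) <->
  v != [ffun=> 0%N].
Proof.
move=> simP; rewrite total_deg_macaulay; split=> [[i [i1 /oppr_inj[sE]]]|v0].
  apply: contraTneq i1 => v0; rewrite -sE big1 // => w _.
  suff -> : mexp v w = 0%N by [].
  by rewrite /mexp v0; case: insub => [j|] //=; rewrite ffunE.
exists (\sum_w mexp v w * #|supp (val w)|)%N; split=> //.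
have [w w0] := macaulay_neq0P v0; rewrite (bigD1 w) //= addn_gt0 muln_gt0.
by rewrite lt0n w0 supp_neq0 // (valP w).
Qed.

Definition mon1 (x : P) : Emon x := ([ffun=> 0], [ffun=> 0%N]).

Lemma lexp0 (x : P) j : lexp (mon1 x).1 j = 0.
Proof. by rewrite /lexp; case: insub => [i|] //=; rewrite ffunE. Qed.

Lemma mexp0 (x : P) w : mexp (mon1 x).2 w = 0%N.
Proof. by rewrite /mexp; case: insub => [i|] //=; rewrite ffunE. Qed.

Lemma deg_mon1 (x : P) : deg_mon (mon1 x) = 0.
Proof.
apply/ffunP => j; rewrite deg_monE lexp0 ffunE big1 ?subr0 // => w _.
by rewrite mexp0 mul0r.
Qed.

(** * Existence *)

Section Existence.
Context {K : fieldType} {x z : P}.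
Context (simP : simplicial P) (le_zx : (z <= x)%O).

Lemma msupp_clean_map (e : {malg K[Emon x]}) (c : Emon z) :
  c \in msupp (clean_map e) ->
  exists2 b, b \in msupp e & clean_coef b c != 0%N.
Proof.
rewrite -mcoeff_neq0 mcoeff_clean_map // => nz.
have [/allP all0|/allPn[b be b0]] :=
  boolP (all (fun b => clean_coef b c == 0%N) (msupp e)); last by exists b.
case/eqP: nz; rewrite big_seq big1 // => b /all0/eqP ->.
by rewrite mulr0.
Qed.

Lemma clean_map_homogeneous a (e : E K x) :
  homogeneous a e -> homogeneous a (clean_map e : E K z).
Proof.
move=> hom_e c /msupp_clean_map[b be] /clean_coef_neq0[<- _].
exact: hom_e.
Qed.

Lemma clean_map_in_L (e : E K x) : in_L e -> in_L (clean_map e : E K z).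
Proof.
move=> Le c /msupp_clean_map[b be] /clean_coef_neq0[<- wt_bc].
have [/(total_deg_macaulay_lt0 _ simP) b0 deg_b] := Le b be; split=> //.
apply/(total_deg_macaulay_lt0 _ simP); have [w bw] := macaulay_neq0P b0.
apply: contraNneq (wt_bc w) => c0; have -> : mexp c.2 w = 0%N.
  by rewrite c0 (mexp0 z).
by rewrite /wt bin0n [0%N == _]eq_sym (negPf bw) if_same.
Qed.

Lemma mcoeff_clean_map1 :
  (clean_map << mon1 x >> : {malg K[Emon z]})@_(mon1 z) = 1.
Proof.
rewrite clean_mapU mcoeff_clean_row // /clean_coef !deg_mon1 eqxx.
rewrite /wt_prod big1 // => w _; rewrite !mexp0 /wt bin0 eqxx.
by case: ifP.
Qed.

End Existence.

(** * Uniqueness *)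

Section Uniqueness.
Context {K : fieldType} {x z : P}.
Context (simP : simplicial P) (le_zx : (z <= x)%O).
Context (D : {linear E K x -> E K z}).

(** Induction on the exponents of the second factor: the coefficient of [D e]
    at [u (x) t_w^-1 v] is that of [t_w (D e) = D (t_w e)] at [u (x) v] minus,
    if [w <= z], that of [D e] at [pi_z(t_w)^-1 u (x) v], and both of these
    have the second factor [v]. *)
Lemma mcoeff0_macaulay :
  (forall b u, (D << b >>)@_((u, [ffun=> 0%N]) : Emon z) = 0) ->
  forall e, D e = 0.
Proof.
move=> D0 e; apply/malgP => -[u v]; rewrite mcoeff0.
have [n] := ubnP (\sum_w mexp v w); elim: n => // n IHn in v u e *.
have [->|/macaulay_neq0P[w]] := eqVneq v [ffun=> 0%N].
  have Ddelta (e' : {malg K[Emon x]}) : (D e')@_((u, [ffun=> 0%N]) : Emon z) = 0.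
    rewrite (malg_sum e') linear_sum raddf_sum /= big1 // => b _.
    by rewrite linear_malgZ mcoeffZ D0 mulr0.
  by [].
case: macaulay_actP => // v1 wz vE _ lt_vn.
have lt_v1 : (\sum_w mexp v1 w < n)%N.
  move: lt_vn; rewrite vE ltnS; under eq_bigr do rewrite mexp_mdiv //.
  by rewrite big_split (bigD1 w (F := fun i => nat_of_bool (i == w))) //= eqxx; lia.
have := mcoeff_t_act w (D e) ((u, v1) : Emon z).
by rewrite -linear_t_act /= wz !(IHn v1) // if_same add0r -vE => <-.
Qed.

Lemma t_act_atom (y : P) w u v : val w \in atoms -> (val w <= y)%O ->
  t_act w << ((ldiv w u, v) : Emon y) >> = << ((u, v) : Emon y) >>
    :> {malg K[Emon y]}.
Proof.
move=> w_atom le_wy; apply/malgP => -[u1 v1].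
rewrite mcoeff_t_act le_wy in_PminusE // w_atom /= addr0 !mcoeffU !xpair_eqE.
congr (_ *+ (_ && _)); apply/eqP/eqP => [|-> //].
by move/ffunP => E; apply/ffunP => i; have := E i; rewrite !ffunE => /addIr.
Qed.

Lemma ldiv_surj (y : P) w (u : laurent_mon y) : exists u1, u = ldiv w u1.
Proof.
exists [ffun i => u i + (val i \in supp (val w))%:R].
by apply/ffunP => i; rewrite !ffunE addrK.
Qed.

(** The invertible [t_i], [i] in [supp z], translate coefficients along the
    first factor. *)
Lemma mcoeff_ldiv w b u : val w \in atoms -> (val w <= z)%O ->
  (D << b >>)@_((u, [ffun=> 0%N]) : Emon z) =
  (D << ((ldiv w b.1, b.2) : Emon x) >>)@_((ldiv w u, [ffun=> 0%N]) : Emon z).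
Proof.
move=> w_atom le_wz; case: b => u0 v0.
rewrite -(t_act_atom u0 v0 w_atom (le_trans le_wz le_zx)) linear_t_act.
by rewrite mcoeff_t_act le_wz in_PminusE // w_atom addr0.
Qed.

Lemma mcoeff1_macaulay :
  (forall b, (D << b >>)@_(mon1 z) = 0) ->
  forall b u, (D << b >>)@_((u, [ffun=> 0%N]) : Emon z) = 0.
Proof.
move=> D1 b u; have [n] := ubnP (\sum_i `|u i|)%N.
elim: n => // n IHn in b u *.
have [->|nz_u] := eqVneq u [ffun=> 0]; first by rewrite D1.
have /existsP[i ui] : [exists i, u i != 0].
  apply: contraNT nz_u => /existsPn u0; apply/eqP/ffunP => i.
  by rewrite ffunE; apply/eqP; have := u0 i; rewrite negbK.
pose w : Pstar P := Sub (atom (val i)) (atom_neq0 _).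
have w_atom : val w \in atoms by apply: enum_valP.
have le_wz : (val w <= z)%O by have := valP i; rewrite inE.
have ldivE (u1 : laurent_mon z) j : ldiv w u1 j = u1 j - (j == i)%:R.
  by rewrite ffunE supp_atom inE val_eqE.
have sumE (u1 : laurent_mon z) : (\sum_j `|ldiv w u1 j| + `|u1 i| =
    \sum_j `|u1 j| + `|ldiv w u1 i|)%N.
  have rest : (\sum_(j | j != i) `|ldiv w u1 j| = \sum_(j | j != i) `|u1 j|)%N.
    by apply: eq_bigr => j /negPf ji; rewrite ldivE ji subr0.
  by rewrite (bigD1 i) //= [in RHS](bigD1 i) //= rest addnC addnA [RHS]addnAC.
move=> lt_un; have [u_neg|u_pos] := ltP (u i) 0.
  case: b => u0 v0; have [u1 uE] := ldiv_surj w u; have [u2 ->] := ldiv_surj w u0.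
  have ui1 : u i = u1 i - 1 by rewrite uE ldivE eqxx.
  have lt_u1 : (\sum_j `|u1 j| < n)%N.
    have arith (m1 m2 : nat) (k : int) : (m2 + `|k| = m1 + `|k - 1|)%N ->
      (m2 < n.+1)%N -> k - 1 < 0 -> (m1 < n)%N by lia.
    by move: (sumE u1) lt_un u_neg; rewrite -uE ui1; apply: arith.
  rewrite uE; have /= <- := mcoeff_ldiv (u2, v0) u1 w_atom le_wz.
  exact: IHn.
rewrite (mcoeff_ldiv b u w_atom le_wz); apply: IHn.
have arith (m1 m2 : nat) (k : int) : (m1 + `|k| = m2 + `|k - 1|)%N ->
  (m2 < n.+1)%N -> 0 <= k -> k != 0 -> (m1 < n)%N by lia.
by move: (sumE u) lt_un u_pos ui; rewrite ldivE eqxx; apply: arith.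
Qed.

(** Only monomials of degree zero can contribute to [1 (x) 1]; apart from
    [1 (x) 1] itself they all lie in [L(E_x)]. *)
Lemma clean_eq0 : clean D -> (D << mon1 x >>)@_(mon1 z) = 0 -> forall e, D e = 0.
Proof.
move=> [homD LD] D1; apply/mcoeff0_macaulay/mcoeff1_macaulay => b.
apply/eqP; rewrite mcoeff_eq0; apply/negP => in_Db.
have hom_b : homogeneous (deg_mon b) (<< b >> : E K x).
  by move=> b'; rewrite msuppU oner_eq0 inE => /eqP ->.
have := homD _ _ hom_b _ in_Db; rewrite deg_mon1 => deg_b.
have [b0|b0] := eqVneq b.2 [ffun=> 0%N].
  have bE : b = mon1 x by apply: Emon_eq; rewrite ?deg_mon1 // b0.
  by move: in_Db; rewrite -mcoeff_neq0 bE D1 eqxx.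
have /LD/(_ _ in_Db)[/(total_deg_macaulay_lt0 _ simP)] : in_L (<< b >> : E K x).
  move=> b'; rewrite msuppU oner_eq0 inE => /eqP ->; split.
    exact/(total_deg_macaulay_lt0 _ simP).
  by move=> j; rewrite -deg_b ffunE.
by rewrite eqxx.
Qed.

End Uniqueness.
End Clean.

Lemma clean_subZ (d : Order.disp_t) (P : finBPOrderType d) (K : fieldType)
    (x z : P) (phi psi : {linear E K x -> E K z}) (c : K) :
  clean phi -> clean psi -> clean (phi \- (c%:MP \*: psi)).
Proof.
move=> [phi_deg phi_L] [psi_deg psi_L].
have supp_sub e b : b \in msupp ((phi \- (c%:MP \*: psi)) e) ->
    b \in msupp (phi e) \/ b \in msupp (psi e).
  rewrite (_ : (_ \- _) e = phi e - S_act c%:MP (psi e)) // S_actC.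
  move=> /(fsubsetP (msuppB_le _ _)); rewrite inE => /orP[|]; first by left.
  by move=> /(fsubsetP (msuppZ_le _ _)); right.
split=> [a e e_a b|e Le b] /supp_sub[].
- exact: phi_deg.
- exact: psi_deg.
- exact: phi_L.
- exact: psi_L.
Qed.

Theorem theorem3p11 (d : Order.disp_t) (P : finBPOrderType d) (K : fieldType)
    (x z : P) (hP : simplicial P) (hzx : (z <= x)%O) :
  exists psi : {linear E K x -> E K z},
    [/\ clean psi,
        exists e : E K x, psi e <> 0
      & forall phi : {linear E K x -> E K z}, clean phi ->
          exists c : K, forall e : E K x, phi e = c%:MP *: psi e].
Proof.
pose m := GRing.isLinear.Build _ _ _ _ _ (@clean_map_S_linear d P K x z hP hzx).
pose psi : {linear E K x -> E K z} := HB.pack (clean_map : E K x -> E K z) m.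
have psi1 : (psi << mon1 x >>)@_(mon1 z) = 1 by apply: mcoeff_clean_map1.
have psi_clean : clean psi.
  by split=> [a e|e]; [apply: clean_map_homogeneous | apply: clean_map_in_L].
exists psi; split=> //; first exists << mon1 x >>.
  by move=> psi0; move/eqP: psi1; rewrite psi0 mcoeff0 eq_sym oner_eq0.
move=> phi phi_clean; pose c := (phi << mon1 x >>)@_(mon1 z); exists c => e.
pose D : {linear E K x -> E K z} := phi \- (c%:MP \*: psi).
suff /(_ e) : forall e, D e = 0 by move/eqP; rewrite subr_eq0 => /eqP.
apply: clean_eq0 => //; first exact: clean_subZ.
rewrite (_ : D _ = phi << mon1 x >> - S_act c%:MP (psi << mon1 x >>)) //.
by rewrite S_actC mcoeffB mcoeffZ psi1 mulr1 subrr.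
Qed.
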